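(* For any general network $\Gamma$, $\mathcal{L}(\Gamma)$ forms a quasi-semilattice with respect to the reducing operation $\mathring{\cup}$ (called a network quasi-semilattice). That is, for any general network $\Gamma$: $\mathcal{L}(\Gamma)$ is closed under $\mathring{\cup}$; $l\mathring{\cup}l=l$ for all $l\in\mathcal{L}(\Gamma)$; $l_1\mathring{\cup}l_2=l_2\mathring{\cup}l_1$ for all $l_1,l_2\in\mathcal{L}(\Gamma)$; and $\mathring{\cup}$ does not satisfy the associative law on $\mathcal{L}(\Gamma)$.
   Context: A general network $\Gamma$ (a correlation network, a logic network or a hybrid of the two) has a finite vertex set $\Gamma^0$ and a finite set $T$ of tensors representing the basic associations between vertices; $T$ is also taken to contain the empty relationship $\emptyset$. A non-empty tensor $t=T_A^B$ is given by a non-empty set $A\subseteq\Gamma^0$ of covariant indexes and a (possibly empty) set $B\subseteq\Gamma^0$ of contra-variant indexes; its index set is $I(t)=A\cup B$. A 2-chain is an unordered pair $\oplus(t_i,t_j)$ of distinct non-empty tensors $t_i,t_j\in T$ with $I(t_i)\cap I(t_j)\neq\emptyset$. A (non-empty) tensor chain is $\oplus(P|S)$, where $P\subseteq T$ is a non-empty set of non-empty tensors, $S$ is a set of 2-chains between elements of $P$, and the pair is connected: any two distinct $t_i,t_j\in P$ are joined by a sequence $t_i=t_{k_1},\dots,t_{k_m}=t_j$ in $P$ with $\oplus(t_{k_\ell},t_{k_{\ell+1}})\in S$ for all $1\le \ell<m$. A tensor chain is determined by $(P,S)$; a single tensor $t$ is the chain with $P=\{t\}$, $S=\varnothing$. $\mathcal{L}(\Gamma)$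 is the set of all non-empty tensor chains together with the empty relation $\emptyset$. Reducing: for non-empty chains $l_1=\oplus(P_1|S_1)$, $l_2=\oplus(P_2|S_2)$, put $l_1\mathring{\cup}l_2=\oplus(P_1\cup P_2|S_1\cup S_2)$ if $P_1\cap P_2\neq\varnothing$ and $l_1\mathring{\cup}l_2=\emptyset$ otherwise; also $\emptyset\mathring{\cup}l=l\mathring{\cup}\emptyset=\emptyset$ for all $l\in\mathcal{L}(\Gamma)$. A quasi-semilattice is an algebraic system with a binary operation that is idempotent and commutative and does not satisfy the associative law.
   Formalization: The failure of associativity is stated only for networks having at least one 2-chain; without 2-chains (e.g. T = {∅, t}) every non-empty chain is a single tensor and reducing is associative. Closure, idempotence and commutativity are stated for every network. *)

(* Defs.v *)
From mathcomp Require Import all_boot.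

Set Implicit Arguments.
Unset Strict Implicit.
Unset Printing Implicit Defensive.

(* The pair (A, B) stands for T_A^B; only the covariant part A has to be
   non-empty. *)
Definition netensor (V : finType) : finType :=
  {AB : {set V} * {set V} | AB.1 != set0}.

(* [None] is the empty relationship. *)
Definition tensor (V : finType) : finType := option (netensor V).

Definition empty_tensor (V : finType) : tensor V := None.

Definition index_set (V : finType) (t : tensor V) : {set V} :=
  if t is Some u then (val u).1 :|: (val u).2 else set0.

Record network := Network {
  vertex : finType;
  tensors : {set tensor vertex};
  empty_in_tensors : empty_tensor vertex \in tensors
}.

Section Chains.

Variable G : network.
Local Notation tensorG := (tensor (vertex G)).

(* The unordered pair of distinct tensors is encoded as a two-element set. *)
Definition two_chain (e : {set tensorG}) : bool :=
  [exists ti in tensors G, exists tj in tensors G,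
     [&& ti != empty_tensor _, tj != empty_tensor _, ti != tj,
         index_set ti :&: index_set tj != set0 & e == [set ti; tj]]].

Definition linked (P : {set tensorG}) (S : {set {set tensorG}}) : rel tensorG :=
  [rel x y | [&& x \in P, y \in P & [set x; y] \in S]].

Definition is_tensor_chain (P : {set tensorG}) (S : {set {set tensorG}}) : bool :=
  [&& P != set0,
      P \subset tensors G :\ empty_tensor _,
      [forall e in S, two_chain e && (e \subset P)] &
      [forall ti in P, forall tj in P, connect (linked P S) ti tj]].

(* [Some (P, S)] is the candidate chain (P|S), not yet required to satisfy the
   conditions on tensor chains, and [None] is the empty relation. *)
Definition prechain : Type :=
  option ({set tensorG} * {set {set tensorG}}).

Definition network_chains : pred prechain :=
  fun l => if l is Some PS then is_tensor_chain PS.1 PS.2 else true.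

Definition reducing (l1 l2 : prechain) : prechain :=
  match l1, l2 with
  | Some (P1, S1), Some (P2, S2) =>
      if P1 :&: P2 != set0 then Some (P1 :|: P2, S1 :|: S2) else None
  | _, _ => None
  end.

End Chains.

Arguments network_chains G l : clear implicits.
Arguments reducing G l1 l2 : clear implicits.

Definition closed_under (X : Type) (D : pred X) (op : X -> X -> X) : Prop :=
  {in D &, forall x y, op x y \in D}.

Definition quasi_semilattice (X : Type) (D : pred X) (op : X -> X -> X) : Prop :=
  [/\ closed_under D op,
      {in D, idempotent_op op},
      {in D &, commutative op} &
      ~ {in D & &, associative op}].

(* Main.v *)
(** Two chains sharing a tensor have a connected union, since any two tensors are
    joined through the shared one. Associativity fails on the triple
    [a], [b], [e] for a 2-chain [e = {a, b}]: the single tensors [a] and [b] are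
    disjoint, so [(a b) e] is empty, whereas [a (b e) = e]. *)

Require Import Defs.
From mathcomp Require Import all_boot.

(** Enlarging [P] and [S] only adds links, so every path survives. This carries the connectivity of
    each chain over to the union. *)
Lemma linked_sub (G : network) (P P' : {set tensor (vertex G)})
    (S S' : {set {set tensor (vertex G)}}) :
  P \subset P' -> S \subset S' ->
  subrel (connect (linked P S)) (connect (linked P' S')).
Proof.
move=> /subsetP sP /subsetP sS; apply: connect_sub => x y /and3P[Px Py Sxy].
by apply/connect1/and3P; rewrite sP ?sP ?sS.
Qed.

Lemma is_tensor_chain_union (G : network) (P1 P2 : {set tensor (vertex G)})
    (S1 S2 : {set {set tensor (vertex G)}}) :
  P1 :&: P2 != set0 -> is_tensor_chain P1 S1 -> is_tensor_chain P2 S2 ->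
  is_tensor_chain (P1 :|: P2) (S1 :|: S2).
Proof.
case/set0Pn=> w /setIP[w1 w2].
case/and4P=> [_ sT1 /forall_inP chain1 /forall_inP conn1].
case/and4P=> [_ sT2 /forall_inP chain2 /forall_inP conn2].
apply/and4P; split.
- by apply/set0Pn; exists w; rewrite inE w1.
- by rewrite subUset sT1.
- apply/forall_inP=> e /setUP[/chain1|/chain2] /andP[-> sP] /=.
    exact: subset_trans sP (subsetUl _ _).
  exact: subset_trans sP (subsetUr _ _).
(* Both directions are recorded, since a tensor of the union serves once as the start and once as
   the end of a path through [w]. *)
- have via_w x : x \in P1 :|: P2 ->
      connect (linked (P1 :|: P2) (S1 :|: S2)) x w &&
      connect (linked (P1 :|: P2) (S1 :|: S2)) w x.
    case/setUP=> Px; apply/andP; split.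
    + by apply: linked_sub (forall_inP (conn1 _ Px) _ w1); apply: subsetUl.
    + by apply: linked_sub (forall_inP (conn1 _ w1) _ Px); apply: subsetUl.
    + by apply: linked_sub (forall_inP (conn2 _ Px) _ w2); apply: subsetUr.
    + by apply: linked_sub (forall_inP (conn2 _ w2) _ Px); apply: subsetUr.
  apply/forall_inP=> x /via_w/andP[xw _]; apply/forall_inP=> y /via_w/andP[_ wy].
  exact: connect_trans wy.
Qed.

Lemma reducing_closed (G : network) :
  closed_under (network_chains G) (reducing G).
Proof.
move=> [[P1 S1]|] [[P2 S2]|] //= c1 c2; rewrite /reducing.
(* In the disjoint case the result is [None], which [network_chains] accepts. *)
by case: ifP => // P12; apply: is_tensor_chain_union.
Qed.

Lemma reducing_idem (G : network) :
  {in network_chains G, idempotent_op (reducing G)}.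
Proof.
(* Non-emptiness of [P] is what keeps [reducing] from collapsing a chain with itself to [None]. *)
by move=> [[P S]|] //= /andP[P0 _]; rewrite /reducing !setUid setIid P0.
Qed.

Lemma reducing_comm (G : network) : commutative (reducing G).
Proof.
by move=> [[P1 S1]|] [[P2 S2]|] //=; rewrite setIC setUC (setUC S1).
Qed.

(** Supplies the two disjoint chains of the counterexample; the only connectivity to check is
    reflexive. *)
Lemma single_tensor_chain (G : network) (t : tensor (vertex G)) :
  t \in tensors G -> t != empty_tensor _ -> is_tensor_chain [set t] set0.
Proof.
move=> Tt t0; apply/and4P; split.
- by apply/set0Pn; exists t; rewrite inE.
- by rewrite sub1set !inE t0.
- by apply/forall_inP=> e; rewrite inE.
- by apply/forall_inP=> x /set1P->; apply/forall_inP=> y /set1P->.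
Qed.

Lemma two_chain_tensor_chain (G : network) (e : {set tensor (vertex G)}) :
  two_chain e -> is_tensor_chain e [set e].
Proof.
move=> e2; have /exists_inP[a Ta /exists_inP[b Tb]] := e2.
case/and5P=> a0 b0 _ _ /eqP def_e; apply/and4P; split.
- by apply/set0Pn; exists a; rewrite def_e !inE eqxx.
- by apply/subsetP=> x; rewrite def_e => /set2P[]->; rewrite !inE ?a0 ?b0.
- by apply/forall_inP=> _ /set1P->; rewrite e2 /=.
- apply/forall_inP=> x ex; apply/forall_inP=> y ey.
  (* Distinct [x] and [y] in [e] are [a] and [b] in some order, so [[set x; y]] is [e] itself, the
     single available link. *)
  have [->|neq_xy] := eqVneq x y; first exact: connect0.
  apply/connect1/and3P; split=> //; rewrite inE.
  move: ex ey neq_xy; rewrite def_e.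
  by move=> /set2P[]-> /set2P[]->; rewrite ?eqxx //= setUC.
Qed.

Lemma reducing_not_assoc (G : network) (e : {set tensor (vertex G)}) :
  two_chain e -> ~ {in network_chains G & &, associative (reducing G)}.
Proof.
move=> e2; have /exists_inP[a Ta /exists_inP[b Tb]] := e2.
case/and5P=> a0 b0 neq_ab _ /eqP def_e assoc.
have ea : a \in e by rewrite def_e !inE eqxx.
have eb : b \in e by rewrite def_e !inE eqxx orbT.
have := assoc (Some ([set a], set0)) (Some ([set b], set0))
  (Some (e, [set e])) (single_tensor_chain _ _ Ta a0)
  (single_tensor_chain _ _ Tb b0) (two_chain_tensor_chain _ _ e2).
have ab0 : [set a] :&: [set b] = set0.
  by apply/eqP; rewrite setI_eq0 disjoints1 inE.
have be0 : [set b] :&: e != set0 by apply/set0Pn; exists b; rewrite !inE eqxx.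
(* The inner product has [[set b] :|: e] as its tensor set, and it meets [[set a]] because [a] lies
   in [e]. *)
have abe0 : [set a] :&: ([set b] :|: e) != set0.
  by apply/set0Pn; exists a; rewrite !inE eqxx ea orbT.
(* The assumed associativity now equates a [Some] on the left with [None] on the right. *)
by rewrite /reducing ab0 eqxx be0 abe0.
Qed.

(* If no 2-chain exists, every non-empty chain is a single tensor and reducing
   is associative, so the failure of associativity needs a 2-chain. *)
Theorem theorem2p6 (G : network) :
  [/\ closed_under (network_chains G) (reducing G),
      {in network_chains G, idempotent_op (reducing G)},
      {in network_chains G &, commutative (reducing G)} &
      (exists e : {set tensor (vertex G)}, two_chain e) ->
        quasi_semilattice (network_chains G) (reducing G)].
Proof.
have comm : {in network_chains G &, commutative (reducing G)}.
  by move=> x y _ _; apply: reducing_comm.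
split=> [||//|[e e2]]; [exact: reducing_closed | exact: reducing_idem |].
split=> //; [exact: reducing_closed | exact: reducing_idem |].
exact: reducing_not_assoc e2.
Qed.
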